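(* For all $n\geq2$ and $k\geq1$, there exists a constant $c=c(n,k)>0$ with the following property. If $p:\mathbb{R}^n\to\mathbb{R}$ is a nonconstant harmonic polynomial of degree at most $k$ and $x_0\in\Sigma_p$, then $$|p(z)|\geq c\,\|p\|_{L^\infty(B(x_0,1))}\operatorname{dist}(z,\Sigma_p)^k\quad\text{for all }z\in B(x_0,1/2).$$
   Context: $\Sigma_p=\{x\in\mathbb{R}^n:p(x)=0\}$ is the zero set of $p$; $B(x,r)$ is the open ball with center $x$ and radius $r$. *)

(* Defs.v *)
From HB Require Import structures.
From mathcomp Require Import all_boot all_order all_algebra.
From mathcomp Require Import all_classical all_reals all_analysis.
(* Imported without its notations, which clash with those of MathComp-Analysis. *)
From mathcomp Require mpoly.
Import (canonicals, coercions) mpoly.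

Set Implicit Arguments.
Unset Strict Implicit.
Unset Printing Implicit Defensive.

Import Order.TTheory GRing.Theory Num.Theory.

Local Open Scope classical_set_scope.
Local Open Scope ring_scope.

(* The normed structure of MathComp-Analysis on ['rV[R]_n] is the sup norm, so
   the Euclidean norm, balls and distance are introduced separately. *)
Definition enorm (R : realType) (n : nat) (x : 'rV[R]_n) : R :=
  Num.sqrt (\sum_(i < n) x ord0 i ^+ 2).

Definition eball (R : realType) (n : nat) (x : 'rV[R]_n) (r : R) :
    set 'rV[R]_n :=
  [set y | enorm (y - x) < r].

Definition edistance (R : realType) (n : nat) (z : 'rV[R]_n)
    (A : set 'rV[R]_n) : R :=
  inf [set enorm (z - y) | y in A].

Definition box (R : realType) (n : nat) (a b : 'rV[R]_n) : set 'rV[R]_n :=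
  [set x | forall i, a ord0 i <= x ord0 i <= b ord0 i].

(* Only meant for [a <= b] coordinatewise; otherwise [box a b] is empty and the
   absolute values merely keep the product nonnegative. *)
Definition box_volume (R : realType) (n : nat) (a b : 'rV[R]_n) : R :=
  \prod_(i < n) `|b ord0 i - a ord0 i|.

(* Sets of n-dimensional Lebesgue (outer) measure zero; the library has
   Lebesgue measure only on the line. *)
Definition lebesgue_null (R : realType) (n : nat) (A : set 'rV[R]_n) : Prop :=
  forall e : R, 0 < e ->
    exists a b : nat -> 'rV[R]_n,
      A `<=` \bigcup_k box (a k) (b k) /\
      (\sum_(0 <= k <oo) (box_volume (a k) (b k))%:E <= e%:E)%E.

(* Essential supremum of [`|f|] over B. *)
Definition Linfty_norm (R : realType) (n : nat) (B : set 'rV[R]_n)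
    (f : 'rV[R]_n -> R) : R :=
  inf [set M | 0 <= M /\ lebesgue_null (B `&` [set x | M < `|f x|])].

Definition peval (R : realType) (n : nat) (p : mpoly.mpoly n R)
    (x : 'rV[R]_n) : R :=
  mpoly.meval (fun i => x ord0 i) p.

Definition zero_set (R : realType) (n : nat) (p : mpoly.mpoly n R) :
    set 'rV[R]_n :=
  [set x | peval p x = 0].

Definition laplacian (R : realType) (n : nat) (p : mpoly.mpoly n R) :
    mpoly.mpoly n R :=
  \sum_(i < n) mpoly.mderiv i (mpoly.mderiv i p).

Definition harmonic_poly (R : realType) (n : nat) (p : mpoly.mpoly n R) : Prop :=
  laplacian p = 0.

Definition nonconstant_poly (R : realType) (n : nat) (p : mpoly.mpoly n R) :
    Prop :=
  forall a : R, p <> mpoly.mpolyC n a.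

(* [mpoly.msize p] is one more than the total degree (and is 0 for p = 0). *)
Definition degree_le (R : realType) (n : nat) (p : mpoly.mpoly n R) (k : nat) :
    Prop :=
  (mpoly.msize p <= k.+1)%N.

(* Main.v *)
From HB Require Import structures.
Require Import Defs.
From mathcomp Require Import all_boot all_order all_algebra.
From mathcomp Require Import all_classical all_reals all_analysis.
From mathcomp Require mpoly.
From mathcomp Require Import polyrcf qpoly ring lra.
Import (canonicals, coercions) mpoly.

(** Let [d] be the distance from [z] to the zero set, and assume [d > 0]. By the
    intermediate value theorem on segments [p] has a constant sign on the ball
    of center [z] and radius [d] ([peval_gt0_ball]); say it is positive there.
    The Harnack inequality bounds [p] on a smaller ball by a multiple of [p z],
    and a polynomial of degree at most [k] that is bounded by [M] on a ball of
    radius comparable to [d] is bounded by a multiple of [M / d ^+ k] at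
    distance 3/2 from the center. Since [x0] is a zero of [p], [d < 1/2], and
    the ball of center [x0] and radius 1 lies within distance 3/2 of [z]; this
    is the claim.

    Both steps are obtained together, without integration in dimension [n],
    from a mean value formula with finitely many nodes. Let [E] be the
    expectation under the standard Gaussian law. Stein's identity
    [E ('X * q) = E q^`()] ([gauss_exp_mulX]), used in each variable, gives
    [E p = p 0] for harmonic [p]. On polynomials of degree at most [k], the
    tensor power of the Gauss-Hermite quadrature computes [E] as a sum with
    positive weights over a finite grid ([gauss_quadrature], [cubatureX]), so
    that [p 0] is a positive combination of the values of [p] on the grid
    ([cubature_harmonic]). If [p] is nonnegative on the grid, each of these
    values is therefore at most a constant times [p 0]. With [k.+1] nodes in
    each direction the grid determines the coefficients of [p] linearly
    ([mcoeff_grid]), so all the coefficients are bounded by a multiple of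
    [p 0], and [p] grows at most like the power [k] of the distance
    ([harmonic_growth]). Translating and dilating the grid into the ball of
    center [z] and radius [d] ([growth_of_positive]) yields the theorem. *)

Set Implicit Arguments.
Unset Strict Implicit.
Unset Printing Implicit Defensive.

Import Order.TTheory GRing.Theory Num.Theory.

Local Open Scope classical_set_scope.
Local Open Scope ring_scope.

(** * Gaussian moments and Hermite polynomials *)

(** The moments of the standard normal law. *)
Fixpoint gauss_moment (R : pzRingType) (a : nat) : R :=
  match a with
  | 0 => 1
  | 1 => 0
  | (b.+1 as c).+1 => c%:R * gauss_moment R b
  end.

(** The expectation of [q] under the standard normal law, taken as a formal
    linear functional so that no integral has to be handled. *)
Definition gauss_exp (R : nzRingType) (q : {poly R}) : R :=
  \sum_(a < size q) q`_a * gauss_moment R a.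

Lemma gauss_expE (R : nzRingType) (q : {poly R}) m : (size q <= m)%N ->
  gauss_exp q = \sum_(a < m) q`_a * gauss_moment R a.
Proof.
move=> hm; rewrite /gauss_exp (big_ord_widen m (fun a => q`_a * gauss_moment R a)) //.
rewrite big_mkcond; apply: eq_bigr => a _; case: ltnP => // h.
by rewrite nth_default // mul0r.
Qed.

Lemma gauss_exp_is_linear (R : comNzRingType) c (p q : {poly R}) :
  gauss_exp (c *: p + q) = c * gauss_exp p + gauss_exp q.
Proof.
set m := maxn (size p) (size q).
have hp : (size p <= m)%N by rewrite leq_maxl.
have hq : (size q <= m)%N by rewrite leq_maxr.
rewrite (gauss_expE hp) (gauss_expE hq) (@gauss_expE _ _ m); last first.
  rewrite (leq_trans (size_polyD _ _)) // geq_max hq andbT.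
  exact: leq_trans (size_scale_leq _ _) hp.
rewrite mulr_sumr -big_split; apply: eq_bigr => a _ /=.
by rewrite coefD coefZ mulrDl mulrA.
Qed.

HB.instance Definition _ (R : comNzRingType) :=
  GRing.isLinear.Build R {poly R} R *%R (@gauss_exp R) (@gauss_exp_is_linear R).

Lemma gauss_expZ (R : comNzRingType) c (p : {poly R}) :
  gauss_exp (c *: p) = c * gauss_exp p.
Proof. exact: linearZ. Qed.

(** Stein's identity. It is a restatement of the recurrence between the
    moments; with [gauss_exp 1 = 1] it determines the functional. *)
Lemma gauss_exp_mulX (R : comNzRingType) (q : {poly R}) :
  gauss_exp ('X * q) = gauss_exp q^`().
Proof.
set m := size q.
rewrite (@gauss_expE _ _ m.+2); last first.
  by rewrite (leq_trans (size_polyMleq _ _)) // size_polyX /= ltnW.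
rewrite (@gauss_expE _ _ m); last first.
  by rewrite (leq_trans (size_poly _ _)) // leq_pred.
rewrite !big_ord_recl coefXM /= mul0r add0r coefXM /= mulr0 add0r.
apply: eq_bigr => a _; rewrite coefXM coef_deriv /=.
by rewrite mulr_natl mulrnAr mulrnAl.
Qed.

Fixpoint hermite (R : nzRingType) n : {poly R} :=
  if n is m.+1 then 'X * hermite R m - (hermite R m)^`() else 1.

Lemma monic_mulX_sub_deriv (R : nzRingType) (q : {poly R}) : q \is monic ->
  size ('X * q - q^`()) = (size q).+1 /\ 'X * q - q^`() \is monic.
Proof.
move=> mon; have q0 := monic_neq0 mon.
have szX : size ('X * q) = (size q).+1 by rewrite -commr_polyX size_mulX.
have ltd : (size (- q^`())%R < size ('X * q)%R)%N.
  by rewrite size_polyN szX ltnW // ltnS lt_size_deriv.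
split; first by rewrite size_polyDl.
by rewrite monicE lead_coefDl // -commr_polyX lead_coefMX.
Qed.

Lemma hermite_size_monic (R : nzRingType) n :
  size (hermite R n) = n.+1 /\ hermite R n \is monic.
Proof.
elim: n => [|n [sz mon]] /=; first by rewrite size_poly1 monic1.
by have [-> ->] := monic_mulX_sub_deriv mon; rewrite sz.
Qed.

Lemma size_hermite (R : nzRingType) n : size (hermite R n) = n.+1.
Proof. by have [] := hermite_size_monic R n. Qed.

Lemma monic_hermite (R : nzRingType) n : hermite R n \is monic.
Proof. by have [] := hermite_size_monic R n. Qed.

(** Differentiation commutes with the recurrence up to one extra copy of the
    preceding polynomial, whence the factor growing by one at each step. *)
Lemma deriv_hermite (R : comNzRingType) n :
  (hermite R n.+1)^`() = n.+1%:R *: hermite R n.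
Proof.
elim: n => [|n IH]; first by rewrite /= mulr1 -polyC1 derivC subr0 derivX scale1r.
have -> : hermite R n.+2 = 'X * hermite R n.+1 - n.+1%:R *: hermite R n.
  by rewrite -IH.
rewrite derivB derivM derivX mul1r derivZ IH -addrA -scalerAr -scalerBr.
by rewrite -[in RHS]natr1 scalerDl scale1r addrC.
Qed.

(** By Stein's identity each step of the Hermite recurrence moves one
    derivative onto the other factor; hence [hermite n] is orthogonal to all
    polynomials of degree below [n]. *)
Lemma gauss_exp_mul_hermite (R : comNzRingType) n (s : {poly R}) :
  gauss_exp (hermite R n * s) = gauss_exp s^`(n).
Proof.
elim: n s => [|n IH] s; first by rewrite mul1r.
rewrite derivSn -IH /= mulrBl -mulrA raddfB /= gauss_exp_mulX derivM.
by rewrite raddfD /= addrC addKr.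
Qed.

(** * Real roots of Hermite polynomials *)

(** If [q] has [n] distinct real roots then ['X * q - q^`()] has [n.+1] of them.
    At a root of [q] only [- q^`()] is left, and [q^`()] changes sign from each
    root of [q] to the next, which gives a root in every gap; the behaviour at
    infinity gives one more root on each side. The sequence [x] is kept
    increasing beyond index [n], so that it is globally injective. *)
Section Interlacing.
Variables (R : rcfType) (n : nat) (x : nat -> R).
Hypothesis x_incr : {homo x : i j / (i < j)%N >-> i < j}.

Let q : {poly R} := \prod_(i < n) ('X - (x i)%:P).
Let h : {poly R} := 'X * q - q^`().

Let h_at_root (i : 'I_n) :
  h.[x i] = - \prod_(j < n | j != i) (x i - x j).
Proof.
pose g : {poly R} := \prod_(j < n | j != i) ('X - (x j)%:P).
have qE : q = ('X - (x i)%:P) * g by rewrite /q (bigD1 i).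
rewrite /h qE derivM derivXsubC mul1r hornerD hornerN hornerM hornerD !hornerM.
rewrite hornerXsubC subrr !mul0r mulr0 sub0r addr0 horner_prod.
by congr (- _); apply: eq_bigr => j _; rewrite hornerXsubC.
Qed.

Let q_monic : q \is monic.
Proof. exact: monic_prod_XsubC. Qed.

Let size_q : size q = n.+1.
Proof. by rewrite /q -big_enum size_prod_XsubC size_enum_ord. Qed.
 
Let h_size_monic : size h = n.+2 /\ h \is monic.
Proof. by rewrite -size_q; apply: monic_mulX_sub_deriv. Qed.

Let h_change i : (i.+1 < n)%N -> h.[x i] * h.[x i.+1] < 0.
Proof.
move=> hi; have hi0 := ltnW hi.
rewrite (h_at_root (Ordinal hi)) (h_at_root (Ordinal hi0)) mulrNN /=.
rewrite (bigD1 (Ordinal hi)) /=; last by rewrite -val_eqE /= gtn_eqF.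
rewrite [X in _ * X](bigD1 (Ordinal hi0)) /=; last by rewrite -val_eqE /= ltn_eqF.
rewrite mulrACA nmulr_rlt0; last first.
  have := x_incr (ltnSn i); nra.
rewrite (eq_bigl (fun j : 'I_n =>
  (j != Ordinal hi0) && (j != Ordinal hi))); last by move=> j; rewrite andbC.
rewrite [X in _ * X](eq_bigl (fun j : 'I_n =>
  (j != Ordinal hi0) && (j != Ordinal hi))); last by move=> j; rewrite andbC.
rewrite -big_split /=; apply: prodr_gt0 => j /andP[].
rewrite -!val_eqE /= => j0 j1.
have [ji|ij] := ltnP j i.
  by rewrite mulr_gt0 // subr_gt0 x_incr // ltnW.
have {}ij : (i.+1 < j)%N by rewrite ltn_neqAle eq_sym j1 ltn_neqAle eq_sym j0.
by rewrite nmulr_rgt0 ?subr_lt0 ?x_incr // ltnW.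
Qed.

Let h_right : (0 < n)%N ->
  exists2 b, x n.-1 < b & h.[x n.-1] * h.[b] < 0.
Proof.
move=> n0.
have [_ hm] := h_size_monic.
have lc : 0 < lead_coef h by rewrite (monicP hm).
have [c hc] := poly_pinfty_gt_lc lc.
exists (Num.max c (x n.-1 + 1)); first by rewrite lt_max ltrDl ltr01 orbT.
rewrite nmulr_rlt0.
  apply: lt_le_trans lc _; apply: hc; by rewrite le_max lexx.
have hn : (n.-1 < n)%N by rewrite prednK.
rewrite (h_at_root (Ordinal hn)) oppr_lt0; apply: prodr_gt0 => j.
rewrite -val_eqE /= => jn; rewrite subr_gt0 x_incr // ltn_neqAle jn.
by rewrite /= -ltnS prednK.
Qed.

Let h_left : (0 < n)%N -> exists2 a, a < x 0 & h.[a] * h.[x 0] < 0.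
Proof.
move=> n0.
have [szh hm] := h_size_monic.
have hqm : h * q \is monic by rewrite monicMl.
(* [h * q] is monic of odd degree, so it is negative far to the left. *)
pose P := - ((h * q) \Po (- 'X)).
have lc : 0 < lead_coef P.
  rewrite lead_coefN lead_coef_comp ?size_polyN ?size_polyX //.
  rewrite lead_coefN lead_coefX (monicP hqm) mul1r.
  have -> : (size (h * q)%R).-1 = (n + n).+1.
    by rewrite size_monicM ?monic_neq0 // szh size_q !addSn !addnS.
  by rewrite -signr_odd oddS addnn odd_double expr1 opprK ltr01.
have [c hc] := poly_pinfty_gt_lc lc.
pose y := Num.max c (1 - x 0).
have ya : - y < x 0 by have : 1 - x 0 <= y; [rewrite le_max lexx orbT | lra].
exists (- y) => //.
have hqa : h.[- y] * q.[- y] < 0.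
  have : 0 < P.[y] by apply: lt_le_trans lc _; apply: hc; rewrite le_max lexx.
  by rewrite /P hornerN horner_comp !hornerE; lra.
have qh : 0 < q.[- y] * h.[x 0].
  rewrite (h_at_root (Ordinal n0)) /q horner_prod (bigD1 (Ordinal n0)) //=.
  rewrite mulrN -mulNr -mulNr -mulrA mulr_gt0 //; first by rewrite !hornerE; lra.
  rewrite -big_split /=; apply: prodr_gt0 => j; rewrite -val_eqE /= => j0.
  have x0j : x 0 < x j by rewrite x_incr // lt0n.
  by rewrite !hornerE nmulr_rgt0; lra.
have q2 : 0 < q.[- y] ^+ 2.
  by rewrite exprn_even_gt0 //=; apply: contraTneq hqa => ->; rewrite mulr0 ltxx.
have := mulr_gt0 qh (_ : 0 < - (h.[- y] * q.[- y])); rewrite oppr_gt0 => /(_ hqa) E.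
rewrite -(pmulr_llt0 _ q2) -oppr_gt0; apply: lt_le_trans E _.
by rewrite le_eqVlt; apply/orP; left; apply/eqP; ring.
Qed.

Lemma interlacing_roots : exists y : nat -> R,
  {homo y : i j / (i < j)%N >-> i < j} /\
  'X * q - q^`() = \prod_(i < n.+1) ('X - (y i)%:P).
Proof.
(* [e] lists the roots of [q] together with a point beyond each extreme root;
   only the first [n.+2] values matter, the others keep [e] increasing. *)
suff [e e_incr e_change] : exists2 e : nat -> R,
    {homo e : i j / (i < j)%N >-> i < j} &
    forall i, (i <= n)%N -> h.[e i] * h.[e i.+1] < 0.
  have /choice [y hy] : forall i, exists r,
      (e i < r < e i.+1) /\ ((i <= n)%N -> root h r).
    move=> i; have ei := e_incr _ _ (ltnSn i).
    case: (leqP i n) => hi; last first.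
      by exists ((e i + e i.+1) / 2); rewrite !(midf_lt ei).
    have [r rin rr] := poly_ivtoo (ltW ei) (e_change i hi).
    by exists r; move: rin; rewrite in_itv.
  have y_incr : {homo y : i j / (i < j)%N >-> i < j}.
    apply: Order.NatMonotonyTheory.homo_ltn_lt => i; have [/andP[_ h1] _] := hy i.
    by have [/andP[h2 _] _] := hy i.+1; apply: lt_trans h1 h2.
  exists y; split => //.
  have [szh hm] := h_size_monic.
  pose rs := [seq y i | i <- iota 0 n.+1].
  have /(_ rs) := @all_roots_prod_XsubC R h; rewrite szh size_map size_iota.
  rewrite -/h (monicP hm) scale1r => -> //.
  - by rewrite big_map -[iota _ _]/(index_iota 0 n.+1) big_mkord.
  - by apply/allP => r /mapP[i]; rewrite mem_iota => /andP[_ hi] ->; apply: (hy i).2.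
  - rewrite uniq_rootsE map_inj_uniq ?iota_uniq // => i j.
    by apply: contra_eq; rewrite neq_ltn => /orP[] /y_incr lt_y;
      rewrite (lt_eqF lt_y, gt_eqF lt_y).
have [n0|n0] := posnP n.
  exists (fun i => i%:R - 2^-1) => [|i].
    by apply: Order.NatMonotonyTheory.homo_ltn_lt => i; rewrite ltrD2r ltr_nat.
  rewrite n0 leqn0 => /eqP ->; rewrite /h /q n0 big_ord0 mulr1 -polyC1 derivC subr0.
  by rewrite !hornerX; lra.
have [a a0 ha] := h_left n0; have [b bn hb] := h_right n0.
pose e i := if i is j.+1 then if (j < n)%N then x j else b + (j - n)%:R else a.
exists e => [|[|i]] /=.
- apply: Order.NatMonotonyTheory.homo_ltn_lt => -[|i] /=; first by rewrite n0.
  have [hi|hi] := ltnP i.+1 n; first by rewrite ltnW // x_incr.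
  have [hi1|hi1] := ltnP i n.
    have -> : i = n.-1.
      by apply: succn_inj; rewrite prednK //; apply/eqP; rewrite eqn_leq hi1 hi.
    by apply: lt_le_trans bn _; rewrite lerDl.
  by rewrite ltrD2l ltr_nat subSn.
- by rewrite n0.
- move=> hi; rewrite hi; have [hi1|hi1] := ltnP i.+1 n; first exact: h_change.
  have -> : i = n.-1.
    by apply: succn_inj; rewrite prednK //; apply/eqP; rewrite eqn_leq hi hi1.
  by rewrite prednK // subnn addr0.
Qed.

End Interlacing.

Lemma hermite_roots (R : rcfType) n : exists x : nat -> R,
  {homo x : i j / (i < j)%N >-> i < j} /\
  hermite R n = \prod_(i < n) ('X - (x i)%:P).
Proof.
elim: n => [|n [x [x_incr hE]]] /=; last by rewrite hE; apply: interlacing_roots.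
exists (fun i => i%:R); split; first by move=> i j; rewrite ltr_nat.
by rewrite big_ord0.
Qed.

(** * Gauss-Hermite quadrature *)

Arguments hermite : simpl never.

(** The nodes are the roots of the Hermite polynomial [H] of degree [n.+1] and
    the weights are the expectations of the Lagrange basis [l]. Division by [H]
    and orthogonality give exactness up to twice the number of nodes.
    Exactness on [l i * hermite n] then computes the weight: it equals
    [n.+1`! / H^`().[x i] ^+ 2], which is positive. *)
Lemma gauss_quadrature (R : rcfType) n : exists (x : nat -> R) (w : 'I_n.+1 -> R),
  [/\ injective x, forall i, 0 < w i &
      forall q : {poly R}, (size q <= n.+1 + n.+1)%N ->
        gauss_exp q = \sum_i w i * q.[x i]].
Proof.
have [x [x_incr hE]] := hermite_roots R n.+1.
have x_inj : injective x.
  move=> i j; apply: contra_eq; rewrite neq_ltn => /orP[] /x_incr ?.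
    by rewrite lt_eqF.
  by rewrite gt_eqF.
have n0 : (0 < n.+1)%N by [].
pose l i : {poly R} := tnth (lagrange n.+1 x) i.
have rootH i : (hermite R n.+1).[x (i : 'I_n.+1)] = 0.
  by rewrite hE (bigD1 i) //= hornerM hornerXsubC subrr mul0r.
have lx i j : (l i).[x (j : 'I_n.+1)] = (i == j)%:R by rewrite lagrange_sample.
have size_l i : size (l i) = n.+1 by rewrite size_lagrange_.
have H0 : hermite R n.+1 != 0 by rewrite monic_neq0 // monic_hermite.
have exact (q : {poly R}) : (size q <= n.+1 + n.+1)%N ->
    gauss_exp q = \sum_i gauss_exp (l i) * q.[x i].
  move=> sq; rewrite [in LHS](divp_eq q (hermite R n.+1)) [_ %/ _ * _]mulrC raddfD /=.
  rewrite gauss_exp_mul_hermite derivn_poly0; last first.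
    by rewrite size_divp // size_hermite leq_subLR.
  have sr : (size (q %% hermite R n.+1)%R <= n.+1)%N.
    by rewrite -ltnS -(size_hermite R n.+1) ltn_modp.
  rewrite raddf0 add0r [X in gauss_exp X](lagrange_gen n0 x_inj sr) raddf_sum.
  apply: eq_bigr => i _; rewrite mul_polyC /= gauss_expZ mulrC; congr (_ * _).
  rewrite [in RHS](divp_eq q (hermite R n.+1)) hornerD hornerM rootH.
  by rewrite mulr0 add0r.
exists x, (fun i => gauss_exp (l i)); split => // i.
(* [g] is [H] divided by ['X - x i], so [g.[x i]] is [H^`().[x i]]. *)
pose g : {poly R} := \prod_(j < n.+1 | j != i) ('X - (x j)%:P).
have g0 : g.[x i] != 0.
  rewrite horner_prod; apply/prodf_neq0 => j ji.
  by rewrite hornerXsubC subr_eq0 (inj_eq x_inj) eq_sym.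
have gH : g.[x i] = n.+1%:R * (hermite R n).[x i].
  rewrite -hornerZ -deriv_hermite hE (bigD1 i) //= -/g derivM derivXsubC mul1r.
  by rewrite hornerD hornerM hornerXsubC subrr mul0r addr0.
have E1 : gauss_exp (l i * hermite R n) = gauss_exp (l i) * (hermite R n).[x i].
  rewrite exact; last first.
    by rewrite (leq_trans (size_polyMleq _ _)) // size_l size_hermite leq_pred.
  rewrite (bigD1 i) //= big1 => [|j ji].
    by rewrite addr0 hornerM lx eqxx mul1r.
  by rewrite hornerM lx eq_sym (negbTE ji) mul0r mulr0.
have gmon : g \is monic by apply: monic_prod_XsubC.
have lcoef : (l i)`_n = g.[x i]^-1.
  rewrite /l lagrangeE // -/g coefCM.
  have sg : size g = n.+1.
    have := size_l i; rewrite /l lagrangeE // -/g size_Cmul // invr_eq0 //.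
  by have := monicP gmon; rewrite lead_coefE sg /= => ->; rewrite mulr1.
have E2 : gauss_exp (l i * hermite R n) = n`!%:R / g.[x i].
  rewrite mulrC gauss_exp_mul_hermite (@gauss_expE _ _ 1); last first.
    apply/leq_sizeP => j j0; rewrite coef_derivn nth_default ?mul0rn //.
    by rewrite size_l -addn1 leq_add2l.
  by rewrite big_ord1 coef_derivn addn0 ffactnn lcoef mulr1 mulr_natl.
have {E1 E2} E : gauss_exp (l i) * g.[x i] ^+ 2 = n.+1`!%:R.
  have H : gauss_exp (l i) * (hermite R n).[x i] = n`!%:R / g.[x i] by rewrite -E1.
  rewrite expr2 {1}gH.
  transitivity (gauss_exp (l i) * (hermite R n).[x i] * n.+1%:R * g.[x i]); first by ring.
  rewrite H factS natrM; field; exact: g0.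
have g2 : 0 < g.[x i] ^+ 2 by rewrite exprn_even_gt0.
by move: (pmulr_lgt0 (gauss_exp (l i)) g2); rewrite E ltr0n fact_gt0 => <-.
Qed.

(** * Gaussian expectation of harmonic polynomials *)

Local Notation mpoly := mpoly.mpoly.
Local Notation mX := (@mpoly.mpolyX _ _).
Local Notation mU := mpoly.mnm1.
Local Notation msub := mpoly.mnm_sub.
Local Notation mcoeff := mpoly.mcoeff.
Local Notation meval := mpoly.meval.
Local Notation mderiv := mpoly.mderiv.
Local Notation mdeg := mpoly.mdeg.

Section GaussianFunctional.
Variables (R : realType) (n : nat).
Implicit Types (m : mpoly.multinom n) (p : mpoly n R).

Definition mgauss m : R := \prod_(i < n) gauss_moment R (m i).

(** Stein's identity in the [i]-th variable, on monomials. The truncated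
    subtraction is harmless: when the exponent of [i] is below 2, both sides
    vanish. *)
Lemma mgauss_sub i m : 
  (m i * (m i).-1)%:R * mgauss (msub (msub m (mU i)) (mU i)) = (m i)%:R * mgauss m.
Proof.
rewrite /mgauss (bigD1 i) //= [in RHS](bigD1 i) //=.
rewrite !mpoly.mnmBE mpoly.mnm1E eqxx.
rewrite (eq_bigr (fun j => gauss_moment R (m j))); last first.
  by move=> j ji; rewrite !mpoly.mnmBE mpoly.mnm1E eq_sym (negbTE ji) !subn0.
rewrite !mulrA; congr (_ * _); case: (m i) => [|[|a]]; first by rewrite !mul0r.
  by rewrite muln0 mul0r mulr0.
by rewrite /= !subSS subn0 natrM -mulrA.
Qed.

Lemma mderiv_sum i (I : Type) (r : seq I) (c : I -> R) (F : I -> mpoly n R) :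
  mderiv i (\sum_(j <- r) c j *: F j) = \sum_(j <- r) c j *: mderiv i (F j).
Proof. by rewrite raddf_sum; apply: eq_bigr => j _; apply: mpoly.mderivZ. Qed.

Lemma laplacian_sum (I : Type) (r : seq I) (c : I -> R) (F : I -> mpoly n R) :
  laplacian (\sum_(j <- r) c j *: F j) = \sum_(j <- r) c j *: laplacian (F j).
Proof.
rewrite /laplacian (eq_bigr (fun i => \sum_(j <- r) c j *: mderiv i (mderiv i (F j)))).
  by rewrite exchange_big /=; apply: eq_bigr => j _; rewrite scaler_sumr.
by move=> i _; rewrite !mderiv_sum.
Qed.

Lemma laplacianX m : laplacian (mX m) =
  \sum_(i < n) (m i * (m i).-1)%:R *: (mX (msub (msub m (mU i)) (mU i)) : mpoly n R).
Proof.
rewrite /laplacian; apply: eq_bigr => i _.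
rewrite mpoly.mderivX mpoly.mderivZ mpoly.mderivX scalerA.
by rewrite mpoly.mnmBE mpoly.mnm1E eqxx subn1 natrM.
Qed.

(** With [G] the standard Gaussian vector, [potential K] is the functional
    that sends [f] to the integral of [s * E (f (s G))] over [s] in [0, 1],
    restricted to the monomials of degree below [K]. As Stein's identity gives
    [d/ds E (f (s G)) = s * E (laplacian f (s G))], it satisfies
    [E f = f 0 + potential K (laplacian f)]. *)
Definition potential K p : R :=
  \sum_(m : mpoly.bmultinom n K) mcoeff m p * (mgauss m / (mdeg m).+2%:R).

Lemma potential_sum K (I : Type) (r : seq I) (c : I -> R) (F : I -> mpoly n R) :
  potential K (\sum_(j <- r) c j *: F j) = \sum_(j <- r) c j * potential K (F j).
Proof.
rewrite /potential (eq_bigr (fun m : mpoly.bmultinom n K => \sum_(j <- r)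
    c j * (mcoeff m (F j) * (mgauss m / (mdeg m).+2%:R)))).
  by rewrite exchange_big /=; apply: eq_bigr => j _; rewrite mulr_sumr.
move=> m _; rewrite raddf_sum mulr_suml; apply: eq_bigr => j _ /=.
by rewrite mpoly.mcoeffZ -mulrA.
Qed.

Lemma potentialX K m : (mdeg m < K)%N ->
  potential K (mX m) = mgauss m / (mdeg m).+2%:R.
Proof.
move=> hm; rewrite /potential (bigD1 (mpoly.BMultinom hm)) //= big1.
  by rewrite mpoly.mcoeffX eqxx mul1r addr0.
move=> j; rewrite -val_eqE /= => jm.
by rewrite mpoly.mcoeffX eq_sym (negbTE jm) mul0r.
Qed.

(** The identity [E f = f 0 + potential K (laplacian f)] on monomials: summing
    Stein's identity over the variables produces the factor [mdeg m], which the
    denominator of [potential] cancels, as the Laplacian lowers the degree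
    by 2. *)
Lemma potential_laplacianX K m : (mdeg m < K)%N ->
  mgauss m = (m == @mpoly.mnm0 n)%:R + potential K (laplacian (mX m)).
Proof.
move=> hm; rewrite laplacianX potential_sum.
have H i : (m i * (m i).-1)%:R * potential K (mX (msub (msub m (mU i)) (mU i))) =
    (m i)%:R * (mgauss m / (mdeg m)%:R).
  have lt_sub : (mdeg (msub (msub m (mU i)) (mU i)) < K)%N.
    by rewrite (leq_ltn_trans _ hm) // (leq_trans (mpoly.mdegB _ _)) // mpoly.mdegB.
  rewrite potentialX // !mulrA mgauss_sub.
  case hi : (m i) => [|[|a]]; first by rewrite !mul0r.
    suff -> : mgauss m = 0 by rewrite mulr0 !mul0r.
    by rewrite /mgauss (bigD1 i) //= hi mul0r.
  congr (_ / _%:R).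
  (* Here [m i >= 2], so subtracting twice in [i] lowers the degree by 2. *)
  have -> : m = mpoly.mnm_add (mpoly.mnm_add
      (msub (msub m (mU i)) (mU i)) (mU i)) (mU i).
    apply/mpoly.mnmP => j; rewrite !mpoly.mnmDE !mpoly.mnmBE !mpoly.mnm1E.
    have [<-|_] := eqVneq i j; last by rewrite !subn0 !addn0.
    by rewrite hi !subn1 !addn1.
  rewrite !mpoly.mdegD mpoly.mdeg1 !addn1; congr (mdeg _).+2.
  apply/mpoly.mnmP => j; rewrite !(mpoly.mnmDE, mpoly.mnmBE, mpoly.mnm1E).
  by case: (i == j); rewrite ?addn1 ?subn1 ?addn0 ?subn0.
rewrite (eq_bigr _ (fun i _ => H i)) -mulr_suml -natr_sum -mpoly.mdegE.
have [->|m0] := eqVneq m (@mpoly.mnm0 n).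
  rewrite mpoly.mdeg0 mul0r addr0 /mgauss big1 // => i _.
  by rewrite mpoly.mnm0E.
rewrite add0r mulrCA divff ?mulr1 //.
by rewrite pnatr_eq0 mpoly.mdeg_eq0.
Qed.

End GaussianFunctional.

(** * A positive cubature formula on a tensor grid *)

Section Cubature.
Variables (R : realType) (n k : nat) (x : nat -> R) (w : 'I_k.+1 -> R).
Implicit Types (p : mpoly n R) (g : {ffun 'I_n -> 'I_k.+1}).

Definition grid g : 'I_n -> R := fun i => x (g i).
Definition weight g : R := \prod_(i < n) w (g i).

Hypothesis exact : forall q : {poly R}, (size q <= k.+1 + k.+1)%N ->
        gauss_exp q = \sum_i w i * q.[x i].

(** Both sides factor over the variables, and each factor is an instance of
    the one-dimensional quadrature. *)
Lemma cubatureX (m : mpoly.multinom n) : (mdeg m <= k)%N ->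
  \sum_g weight g * meval (grid g) (mX m) = mgauss R m.
Proof.
move=> hm; have moment i : gauss_moment R (m i) = \sum_j w j * x j ^+ m i.
  have mk : (m i <= k)%N.
    by apply: leq_trans hm; rewrite mpoly.mdegE (bigD1 i) //= leq_addr.
  have sX : (size ('X^(m i) : {poly R}) <= k.+1 + k.+1)%N.
    by rewrite size_polyXn addSn ltnS (leq_trans mk) // leq_addr.
  rewrite -(eq_bigr _ (fun j _ => congr1 ( *%R (w j)) (hornerXn (x j) (m i)))).
  rewrite -exact // (@gauss_expE _ _ (m i).+1) ?size_polyXn //.
  rewrite big_ord_recr /= big1 => [|j _]; rewrite coefXn.
    by rewrite eqxx add0r mul1r.
  by rewrite ltn_eqF // mul0r.
rewrite /mgauss (eq_bigr _ (fun i _ => moment i)) bigA_distr_bigA /=.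
by apply: eq_bigr => g _; rewrite mpoly.mevalX /weight -big_split.
Qed.

Lemma meval_sum (I : Type) (r : seq I) (c : I -> R) (F : I -> mpoly n R) v :
  meval v (\sum_(j <- r) c j *: F j) = \sum_(j <- r) c j * meval v (F j).
Proof. by rewrite raddf_sum; apply: eq_bigr => j _; rewrite /= mpoly.mevalZ. Qed.

(** A mean value property with finitely many points and positive weights: the
    grid sum is the Gaussian expectation, which differs from the value at the
    origin by the potential of the Laplacian. *)
Lemma cubature_harmonic p : degree_le p k -> harmonic_poly p ->
  \sum_g weight g * meval (grid g) p = meval (fun=> 0) p.
Proof.
move=> hp harm_p.
have harm : \sum_(m : mpoly.bmultinom n k.+1)
    mcoeff m p * potential k.+1 (laplacian (mX m : mpoly n R)) = 0.
  rewrite -potential_sum -laplacian_sum -mpoly.mpolywE // harm_p.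
  by rewrite /potential big1 // => m _; rewrite mpoly.mcoeff0 mul0r.
rewrite [in LHS](mpoly.mpolywE hp) [in RHS](mpoly.mpolywE hp).
under eq_bigr do rewrite meval_sum mulr_sumr.
rewrite exchange_big /= meval_sum.
transitivity (\sum_(m : mpoly.bmultinom n k.+1) mcoeff m p * (meval (fun=> 0) (mX m)
   + potential k.+1 (laplacian (mX m : mpoly n R)))).
  apply: eq_bigr => m _; under eq_bigr do rewrite mulrCA.
  rewrite -mulr_sumr cubatureX; last by rewrite -ltnS mpoly.bmdeg.
  congr (_ * _); rewrite (potential_laplacianX R (mpoly.bmdeg m)); congr (_ + _).
  rewrite mpoly.mevalX; have [->|m0] := eqVneq (m : mpoly.multinom n) (@mpoly.mnm0 n).
    by rewrite big1 // => i _; rewrite mpoly.mnm0E.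
  move: m0; rewrite -mpoly.mdeg_eq0 mpoly.mdegE sum_nat_eq0 negb_forall.
  by move=> /existsP[i /= mi]; rewrite (bigD1 i) //= expr0n (negbTE mi) mul0r.
under eq_bigr do rewrite mulrDr.
by rewrite big_split /= harm addr0.
Qed.

Hypothesis x_inj : injective x.

Definition lagrange_coef (m : mpoly.multinom n) g : R :=
  \prod_(i < n) (tnth (lagrange k.+1 x) (g i) : {poly R})`_(m i).

(** Tensor Lagrange interpolation: the grid has [k.+1] nodes in each
    direction, so it determines a polynomial of degree at most [k]. Recovering
    coefficients rather than values keeps track of the total degree. *)
Lemma mcoeff_grid p (m : mpoly.multinom n) : degree_le p k ->
  mcoeff m p = \sum_g lagrange_coef m g * meval (grid g) p.
Proof.
move=> hp; rewrite {2}(mpoly.mpolywE hp).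
under eq_bigr do rewrite meval_sum mulr_sumr.
rewrite exchange_big /= {1}(mpoly.mpolywE hp) raddf_sum /=.
apply: eq_bigr => b _; under eq_bigr do rewrite mulrCA.
rewrite -mulr_sumr mpoly.mcoeffZ mpoly.mcoeffX; congr (_ * _).
under eq_bigr do rewrite mpoly.mevalX /lagrange_coef -big_split /=.
rewrite -(bigA_distr_bigA (fun i j =>
  (tnth (lagrange k.+1 x) j : {poly R})`_(m i) * x j ^+ b i)).
have bk i : (b i <= k)%N.
  have := mpoly.bmdeg b; rewrite ltnS; apply: leq_trans.
  by rewrite mpoly.mdegE (bigD1 i) //= leq_addr.
transitivity (\prod_(i < n) ((m i == b i)%:R : R)).
  have [->|bm] := eqVneq (b : mpoly.multinom n) m.
    by rewrite big1 // => i _; rewrite eqxx.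
  have /existsP[i mi] : [exists i, m i != b i].
    rewrite -negb_forall; apply: contra bm => /forallP mb.
    by apply/eqP/mpoly.mnmP => i; rewrite (eqP (mb i)).
  by rewrite (bigD1 i) //= (negbTE mi) mul0r.
apply: eq_bigr => i _.
have sX : (size ('X^(b i) : {poly R}) <= k.+1)%N by rewrite size_polyXn ltnS.
rewrite -coefXn (lagrange_gen (ltn0Sn k) x_inj sX) coef_sum.
by apply: eq_bigr => j _; rewrite coefCM hornerXn mulrC.
Qed.

End Cubature.

(** * Growth of harmonic polynomials that are nonnegative near the origin *)

(** A Harnack inequality combined with polynomial growth. By the mean value
    formula the value of a nonnegative [p] at each grid point is at most
    [p 0] divided by the weight of that point; interpolation then bounds every
    coefficient of [p] by a multiple of [p 0]. *)
Lemma harmonic_growth (R : realType) (n k : nat) : exists B C : R,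
  [/\ 0 <= B, 0 < C & forall p : mpoly n R,
    degree_le p k -> harmonic_poly p ->
    (forall v, (forall i, `|v i| <= B) -> 0 <= meval v p) ->
    forall r (y : 'I_n -> R), 1 <= r -> (forall i, `|y i| <= r) ->
    `|meval y p| <= C * meval (fun=> 0) p * r ^+ k].
Proof.
have [x [w [x_inj w_gt0 exact]]] := gauss_quadrature R k.
pose K (m : mpoly.multinom n) : R := \sum_g `|lagrange_coef x m g| / weight w g.
have W0 (g : {ffun 'I_n -> 'I_k.+1}) : 0 < weight w g by apply: prodr_gt0.
have K0 (m : mpoly.multinom n) : 0 <= K m.
  by apply: sumr_ge0 => g _; rewrite divr_ge0 // ltW.
pose B : R := \sum_(j < k.+1) `|x j|.
exists B, (1 + \sum_(m : mpoly.bmultinom n k.+1) K m); split.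
- by apply: sumr_ge0.
- by rewrite ltr_wpDr // sumr_ge0.
move=> p deg_p harm_p p_ge0 r y r_ge1 y_le; set p0 := meval (fun=> 0) p.
have pg (g : {ffun 'I_n -> 'I_k.+1}) : 0 <= meval (grid x g) p.
  apply: p_ge0 => i; rewrite /B (bigD1 (g i)) //= lerDl; exact: sumr_ge0.
have p0E : \sum_g weight w g * meval (grid x g) p = p0.
  exact: cubature_harmonic.
have p0_ge0 : 0 <= p0.
  by rewrite -p0E; apply: sumr_ge0 => h _; rewrite mulr_ge0 // ltW.
have pg_le g : meval (grid x g) p <= p0 / weight w g.
  rewrite ler_pdivlMr // mulrC -p0E (bigD1 g) //= lerDl.
  by apply: sumr_ge0 => h _; rewrite mulr_ge0 // ltW.
have pm (m : mpoly.multinom n) : `|mcoeff m p| <= K m * p0.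
  rewrite (mcoeff_grid x_inj m deg_p) /K mulr_suml.
  apply: le_trans (ler_norm_sum _ _ _) _; apply: ler_sum => g _.
  rewrite normrM (ger0_norm (pg g)) mulrAC -mulrA.
  by rewrite ler_wpM2l.
rewrite {1}(mpoly.mpolywE deg_p) meval_sum.
apply: le_trans (ler_norm_sum _ _ _) _.
apply: (@le_trans _ _ (\sum_(m : mpoly.bmultinom n k.+1) K m * p0 * r ^+ k)).
  apply: ler_sum => m _; rewrite normrM ler_pM //.
  rewrite mpoly.mevalX normr_prod.
  apply: (@le_trans _ _ (\prod_(i < n) r ^+ m i)).
    apply: ler_prod => i _; rewrite normr_ge0 normrX lerXn2r ?nnegrE //.
    exact: le_trans r_ge1.
  rewrite prodrXr -mpoly.mdegE ler_weXn2l //.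
  by rewrite -ltnS mpoly.bmdeg.
rewrite -!mulr_suml ler_wpM2r ?exprn_ge0 ?(le_trans _ r_ge1) //.
by rewrite ler_wpM2r // lerDr.
Qed.

(** * Translation and dilation of polynomials *)

Lemma monomial_ind (R : realType) (n : nat) (P : mpoly n R -> Prop) :
  P 1 -> (forall q1 q2, P q1 -> P q2 -> P (q1 * q2)) ->
  (forall i, P (mX (mU i))) -> forall m, P (mX m).
Proof.
move=> P1 PM PX m; rewrite mpoly.mpolyXE_id; elim/big_ind: _ => // i _.
by elim: (m i) => [|d IH]; [rewrite expr0 | rewrite exprS; apply: PM].
Qed.

Section Rescaling.
Variables (R : realType) (n : nat) (z : 'I_n -> R) (s : R).

Let A (i : 'I_n) : mpoly n R := mpoly.mpolyC n (z i) + s *: mX (mU i).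

Definition rescale (p : mpoly n R) : mpoly n R := mpoly.mmap (@mpoly.mpolyC n R) A p.

Lemma meval_rescale v p : meval v (rescale p) = meval (fun i => z i + s * v i) p.
Proof.
rewrite /rescale /mpoly.mmap raddf_sum mpoly.mevalE; apply: eq_bigr => m _ /=.
rewrite mpoly.mevalM mpoly.mevalC; congr (_ * _).
rewrite rmorph_prod; apply: eq_bigr => i _ /=.
by rewrite rmorphXn /= mpoly.mevalD mpoly.mevalC mpoly.mevalZ mpoly.mevalXU.
Qed.

Lemma rescaleZ c p : rescale (c *: p) = c *: rescale p.
Proof. by rewrite /rescale mpoly.mmapZ mpoly.mul_mpolyC. Qed.

Let rescale0 : rescale 0 = 0.
Proof. exact: raddf0. Qed.

Let rescaleD p q : rescale (p + q) = rescale p + rescale q.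
Proof. exact: mpoly.mmapD. Qed.

Let rescale_sum (F : 'I_n -> mpoly n R) :
  rescale (\sum_i F i) = \sum_i rescale (F i).
Proof. exact: (big_morph rescale rescaleD rescale0). Qed.

Let rescaleM p q : rescale (p * q) = rescale p * rescale q.
Proof. exact: rmorphM. Qed.

Let rescale1 : rescale 1 = 1.
Proof. exact: rmorph1. Qed.

Let rescaleX i : rescale (mX (mU i)) = A i.
Proof. by rewrite /rescale mpoly.mmapX mpoly.mmap1U. Qed.

(** The chain rule holds on variables and is stable under products, as both
    sides are derivations along [rescale]; hence it holds on monomials, and
    then on all polynomials by linearity. *)
Lemma mderiv_rescale i p : mderiv i (rescale p) = s *: rescale (mderiv i p).
Proof.
pose P p := mderiv i (rescale p) = s *: rescale (mderiv i p).
have P1 : P 1.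
  by rewrite /P rescale1 -mpoly.mpolyC1 !mpoly.mderivC rescale0 scaler0.
have PM q1 q2 : P q1 -> P q2 -> P (q1 * q2).
  rewrite /P => e1 e2; rewrite rescaleM !mpoly.mderivM rescaleD !rescaleM e1 e2.
  by rewrite scalerDr -scalerAl -scalerAr.
have PX j : P (mX (mU j)).
  rewrite /P rescaleX mpoly.mderivD mpoly.mderivC add0r mpoly.mderivZ.
  congr (_ *: _); rewrite mpoly.mderivX rescaleZ mpoly.mnm1E.
  have [->|_] := eqVneq j i; last by rewrite !scale0r.
  congr (_ *: _).
  have -> : msub (mU i) (mU i) = @mpoly.mnm0 n.
    by apply/mpoly.mnmP => l; rewrite mpoly.mnmBE subnn mpoly.mnm0E.
  by rewrite mpoly.mpolyX0 rescale1.
have PXm m : P (mX m) by apply: monomial_ind.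
rewrite -/(P p); elim/mpoly.mpolyind: p => [|c m q _ _ IH].
  by rewrite /P rescale0 !mpoly.mderiv0 rescale0 scaler0.
rewrite /P rescaleD !mpoly.mderivD rescaleD IH scalerDr; congr (_ + _).
rewrite rescaleZ !mpoly.mderivZ rescaleZ scalerA mulrC -scalerA; congr (_ *: _).
exact: PXm.
Qed.

Lemma harmonic_rescale p : harmonic_poly p -> harmonic_poly (rescale p).
Proof.
rewrite /harmonic_poly => harm.
suff -> : laplacian (rescale p) = s *: (s *: rescale (laplacian p)).
  by rewrite harm rescale0 !scaler0.
rewrite /laplacian rescale_sum !scaler_sumr; apply: eq_bigr => i _.
by rewrite mderiv_rescale mpoly.mderivZ mderiv_rescale.
Qed.

Lemma degree_le_rescale p k : degree_le p k -> degree_le (rescale p) k.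
Proof.
rewrite /degree_le => deg_p.
have degM (q1 q2 : mpoly n R) d1 d2 : (mpoly.msize q1 <= d1.+1)%N ->
    (mpoly.msize q2 <= d2.+1)%N -> (mpoly.msize (q1 * q2)%R <= (d1 + d2).+1)%N.
  have [->|q10] := eqVneq q1 0; first by rewrite mul0r mpoly.msize0.
  have [->|q20] := eqVneq q2 0; first by rewrite mulr0 mpoly.msize0.
  move=> h1 h2; rewrite mpoly.msizeM //.
  by have := leq_add h1 h2; rewrite addSn addnS; case: (_ + _)%N => // a /ltnW.
have degA i : (mpoly.msize (A i) <= 2)%N.
  rewrite (leq_trans (mpoly.msizeD_le _ _)) // geq_max mpoly.msizeC.
  rewrite (leq_trans (leq_b1 _)) // (leq_trans (mpoly.msizeZ_le _ _)) //.
  by rewrite mpoly.msizeX mpoly.mdeg1.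
rewrite /rescale (mpoly.mmapE _ deg_p) (leq_trans (mpoly.msize_sum _ _ _)) //.
apply/bigmax_leqP => m _.
have mk := mpoly.bmdeg m; rewrite ltnS in mk.
apply: (degM _ _ 0%N k); first by rewrite mpoly.msizeC leq_b1.
apply: (@leq_trans (mdeg m).+1); last by rewrite ltnS.
rewrite mpoly.mdegE /mpoly.mmap1; elim/big_rec2: _; first by rewrite mpoly.msize1.
move=> i q d _ hq; apply: (degM) => //.
elim: (m i) => [|e IH]; first by rewrite expr0 mpoly.msize1.
by rewrite exprS; apply: (degM _ _ 1%N e).
Qed.

End Rescaling.

(** * Euclidean balls, distances and sup norms *)

Section EuclideanGeometry.
Variables (R : realType) (n : nat).
Implicit Types (u v y z : 'rV[R]_n) (p : mpoly n R).

Lemma enorm_ge0 v : 0 <= enorm v.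
Proof. exact: sqrtr_ge0. Qed.

Lemma enormZ c v : enorm (c *: v) = `|c| * enorm v.
Proof.
rewrite /enorm -sqrtr_sqr -sqrtrM ?sqr_ge0 // mulr_sumr; congr Num.sqrt.
by apply: eq_bigr => i _; rewrite mxE exprMn.
Qed.

Lemma enormB u v : enorm (u - v) = enorm (v - u).
Proof. by rewrite -opprB -scaleN1r enormZ normrN1 mul1r. Qed.

Lemma coord_le_enorm v i : `|v ord0 i| <= enorm v.
Proof.
rewrite -sqrtr_sqr ler_sqrt; last by apply: sumr_ge0 => j _; apply: sqr_ge0.
by rewrite (bigD1 i) //= lerDl sumr_ge0 // => j _; apply: sqr_ge0.
Qed.

(** A crude bound that avoids the square root of [n]; the 1 makes it strict
    and keeps the right-hand side positive. *)
Lemma enorm_lt_of_coord B v : 0 <= B -> (forall i, `|v ord0 i| <= B) ->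
  enorm v < 1 + n%:R * B ^+ 2.
Proof.
move=> B0 vB; set L := _ + _.
have nB : 0 <= n%:R * B ^+ 2 by rewrite mulr_ge0 ?sqr_ge0.
have L1 : 1 <= L by rewrite lerDl.
rewrite -(ger0_norm (le_trans ler01 L1)) -sqrtr_sqr ltr_sqrt; last first.
  by rewrite exprn_gt0 // (lt_le_trans ltr01 L1).
apply: (@le_lt_trans _ _ (n%:R * B ^+ 2)); last by rewrite /L; nra.
rewrite mulr_natl -[X in _ *+ X]card_ord -sumr_const; apply: ler_sum => i _.
by rewrite -real_normK ?num_real // lerXn2r ?nnegrE.
Qed.

Lemma lebesgue_null_set0 : (0 < n)%N -> lebesgue_null (set0 : set 'rV[R]_n).
Proof.
move=> n_gt0 e e0; exists (fun=> 0), (fun=> 0); split; first exact: sub0set.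
rewrite eseries0 ?lee_fin ?ltW // => i _ _.
by rewrite /box_volume (bigD1 (Ordinal n_gt0)) //= mxE subrr normr0 mul0r.
Qed.

Lemma Linfty_norm_le (A : set 'rV[R]_n) (f : 'rV[R]_n -> R) M :
  (0 < n)%N -> 0 <= M -> (forall y, A y -> `|f y| <= M) -> Linfty_norm A f <= M.
Proof.
move=> n_gt0 M0 fM; apply: ge_inf; first by exists 0 => x [].
split => //; suff -> : A `&` [set x | M < `|f x|] = set0.
  exact: lebesgue_null_set0.
by apply/seteqP; split => // y [/= /fM]; rewrite leNgt => /negP.
Qed.

Lemma edistance_le z (A : set 'rV[R]_n) y : A y -> edistance z A <= enorm (z - y).
Proof.
move=> Ay; apply: ge_inf; last by exists y.
by exists 0 => _ [x _ <-]; apply: enorm_ge0.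
Qed.

Lemma edistance_ge0 z (A : set 'rV[R]_n) : 0 <= edistance z A.
Proof.
have [[y Ay]|A0] := pselect (A !=set0).
  apply: lb_le_inf; first by exists (enorm (z - y)), y.
  by move=> _ [x _ <-]; apply: enorm_ge0.
have -> : A = set0 by apply/seteqP; split => // y Ay; apply: A0; exists y.
by rewrite /edistance image_set0 inf0.
Qed.

(** The restriction of [p] to the line through [z] and [y], as a univariate
    polynomial, to which the intermediate value theorem applies. *)
Definition segment_poly p y z : {poly R} :=
  mpoly.mmap polyC (fun i => (z ord0 i)%:P + (y ord0 i - z ord0 i) *: 'X) p.

Lemma horner_segment_poly p y z t :
  (segment_poly p y z).[t] = peval p (z + t *: (y - z)).
Proof.
rewrite /peval mpoly.mevalE /segment_poly /mpoly.mmap horner_sum.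
apply: eq_bigr => m _; rewrite hornerM hornerC; congr (_ * _).
rewrite horner_prod; apply: eq_bigr => i _; rewrite horner_exp; congr (_ ^+ _).
by rewrite hornerD hornerC hornerZ hornerX !mxE mulrC.
Qed.

Lemma peval_gt0_ball p z d : (forall y, enorm (y - z) < d -> peval p y != 0) ->
  0 < peval p z -> forall y, enorm (y - z) < d -> 0 < peval p y.
Proof.
move=> no_zero pz y yd; rewrite ltNge; apply/negP => py.
have {}py : peval p y < 0 by rewrite lt_neqAle no_zero.
have sign : (segment_poly p y z).[0] * (segment_poly p y z).[1] < 0.
  by rewrite !horner_segment_poly scale0r addr0 scale1r addrC subrK pmulr_rlt0.
have [t] := poly_ivtoo ler01 sign; rewrite in_itv /= => /andP[t0 t1].
rewrite /root horner_segment_poly; apply/negP; apply: no_zero.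
rewrite addrC addKr enormZ gtr0_norm //; apply: le_lt_trans yd.
by rewrite ler_piMl ?enorm_ge0 // ltW.
Qed.

End EuclideanGeometry.

(** * The lower bound by the distance to the zero set *)

(** [harmonic_growth] transported to the ball of center [z] and radius [d].
    The scale [s = d / L] is chosen so that the cube of half-side [B], on which
    [harmonic_growth] needs nonnegativity, is mapped into this ball. *)
Lemma growth_of_positive (R : realType) (n k : nat) : exists C L : R,
  [/\ 0 < C, 1 <= L & forall (p : mpoly n R) (z : 'rV[R]_n) (d : R),
    degree_le p k -> harmonic_poly p -> 0 < d ->
    (forall y, enorm (y - z) < d -> 0 < peval p y) ->
    forall r (y : 'rV[R]_n), d <= r * L -> (forall i, `|y ord0 i - z ord0 i| <= r) ->
    `|peval p y| * d ^+ k <= C * peval p z * (r * L) ^+ k].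
Proof.
have [B [C [B0 C0 growth]]] := harmonic_growth R n k.
pose L := 1 + n%:R * B ^+ 2.
have L1 : 1 <= L by rewrite lerDl mulr_ge0 ?sqr_ge0.
have L0 : 0 < L by apply: lt_le_trans L1.
exists C, L; split => // p z d deg_p harm_p d0 p_gt0 r y dr y_le.
pose s := d / L; have s0 : 0 < s by rewrite divr_gt0.
pose q := rescale (fun i => z ord0 i) s p.
have q0 : meval (fun=> 0) q = peval p z.
  by rewrite meval_rescale; apply: mpoly.meval_eq => i; rewrite mulr0 addr0.
have qy : meval (fun i => (y ord0 i - z ord0 i) / s) q = peval p y.
  rewrite meval_rescale; apply: mpoly.meval_eq => i.
  by rewrite mulrC divfK ?gt_eqF // addrC subrK.
have qB v : (forall i, `|v i| <= B) -> 0 <= meval v q.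
  move=> vB; pose u : 'rV[R]_n := \row_i v i.
  have -> : meval v q = peval p (z + s *: u).
    by rewrite meval_rescale; apply: mpoly.meval_eq => i; rewrite !mxE.
  apply/ltW/p_gt0; rewrite addrC addKr enormZ gtr0_norm //.
  rewrite /s mulrAC ltr_pdivrMr // ltr_pM2l //.
  by apply: enorm_lt_of_coord => // i; rewrite mxE.
have /(_ (r / s) (fun i => (y ord0 i - z ord0 i) / s)) :=
  growth q (degree_le_rescale _ _ deg_p) (harmonic_rescale _ _ harm_p) qB.
rewrite q0 qy => H.
have dk : 0 < d ^+ k by rewrite exprn_gt0.
have E : (r / s) ^+ k * d ^+ k = (r * L) ^+ k.
  by rewrite -exprMn /s; congr (_ ^+ _); field; rewrite !gt_eqF.
rewrite -E mulrA ler_pM2r //; apply: H.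
  by rewrite ler_pdivlMr // mul1r /s ler_pdivrMr.
move=> i; rewrite normrM normfV (gtr0_norm s0) ler_pM2r ?invr_gt0 //.
Qed.

Theorem theorem3p1 (R : realType) (n k : nat) (hn : (2 <= n)%N) (hk : (1 <= k)%N) :
  exists c : R, 0 < c /\
    forall (p : mpoly.mpoly n R) (x0 : 'rV[R]_n),
      nonconstant_poly p ->
      harmonic_poly p ->
      degree_le p k ->
      zero_set p x0 ->
      forall z : 'rV[R]_n,
        eball x0 (1 / 2) z ->
        c * Linfty_norm (eball x0 1) (peval p) * edistance z (zero_set p) ^+ k
          <= `|peval p z|.
Proof.
have [C [L [C0 L1 growth]]] := growth_of_positive R n k.
have L0 : 0 < L by apply: lt_le_trans L1.
(* 3 / 2 bounds the distance from a point of the ball of radius 1/2 to a point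
   of the concentric ball of radius 1. *)
pose K := C * (3 / 2 * L) ^+ k.
have K0 : 0 < K by rewrite mulr_gt0 // exprn_gt0 // mulr_gt0.
exists K^-1; split; first by rewrite invr_gt0.
move=> p x0 _ harm_p deg_p px0 z zx0; set d := edistance _ _.
have := edistance_ge0 z (zero_set p); rewrite -/d le_eqVlt.
case/predU1P => [<-|d0]; first by rewrite expr0n (gtn_eqF hk) mulr0.
have zx0' : enorm (z - x0) < 1 / 2 by [].
(* [x0] is itself a zero of [p], so the distance is below 1/2. *)
have d_le : d < 1 / 2 by apply: le_lt_trans (edistance_le _ px0) zx0'.
have no_zero y : enorm (y - z) < d -> peval p y != 0.
  apply: contraTneq => py; rewrite -leNgt enormB; exact: edistance_le.
have dist y : eball x0 1 y -> forall i, `|y ord0 i - z ord0 i| <= 3 / 2.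
  move=> yx0 i; have h1 := coord_le_enorm (y - x0) i.
  have h2 := coord_le_enorm (z - x0) i; rewrite !mxE in h1 h2.
  have yx0' : enorm (y - x0) < 1 by [].
  have := ler_normB (y ord0 i - x0 ord0 i) (z ord0 i - x0 ord0 i).
  by rewrite opprB addrA subrK; lra.
have dL : d <= 3 / 2 * L by nra.
have bound y : eball x0 1 y -> `|peval p y| * d ^+ k <= K * `|peval p z|.
  move=> yx0; rewrite /K mulrAC.
  have pN v : peval (- p) v = - peval p v by rewrite /peval mpoly.mevalN.
  have [pz|pz] : 0 < peval p z \/ 0 < peval (- p) z.
    have := no_zero z; rewrite subrr -[X in enorm X](scale0r 0) enormZ normr0 mul0r.
    move=> /(_ d0) pz; rewrite pN oppr_gt0; apply/orP.
    by rewrite orbC -neq_lt.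
  - rewrite (gtr0_norm pz); apply: growth => //; last exact: dist.
    exact: peval_gt0_ball no_zero pz.
  - rewrite -[`|peval p y|]normrN -[`|peval p z|]normrN -!pN (gtr0_norm pz).
    apply: growth => //; last exact: dist.
    + by rewrite /degree_le mpoly.msizeN.
    + have := harm_p; rewrite /harmonic_poly /laplacian => harm.
      rewrite (eq_bigr (fun i => - mderiv i (mderiv i p))).
        by rewrite sumrN harm oppr0.
      by move=> i _; rewrite !mpoly.mderivN.
    + apply: peval_gt0_ball pz => v /no_zero; by rewrite pN oppr_eq0.
have dk : 0 < d ^+ k by rewrite exprn_gt0.
rewrite -mulrA mulrC ler_pdivrMr // -ler_pdivlMr //.
apply: Linfty_norm_le; first exact: ltnW.
  by rewrite divr_ge0 ?(ltW dk) // mulr_ge0 // ltW.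
by move=> y yx0; rewrite ler_pdivlMr // [_ * K]mulrC bound.
Qed.
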